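(* Let $k\ge1$, $m\ge0$, $q\ge1$ be integers and for $(t,\eta)\in\mathbb{P}\times\mathbb{P}$ let $$g(t,\eta)=g_{m,k}(t,\eta)=\sum_{\deg Y\le k-1}\sum_{\deg Z\le m}E(tYZ)\sum_{\deg U=0}E(\eta YU).$$ Then $g(t,\eta)=2^{k+m+1-r(D_{(1+m)\times k}(t))}$ if $r(D_{(1+m)\times k}(t))=r(D^{[1;1+m]\times k}(t,\eta))$, and $g(t,\eta)=0$ otherwise. Moreover $$\int_{\mathbb{P}}\int_{\mathbb{P}}g^q(t,\eta)\,dt\,d\eta=2^{q(k+m+1)-2k-m}\sum_{i=0}^{\min(k,1+m)}\sigma_{i,i}^{[1;1+m]\times k}2^{-iq}.$$
   Context: $\mathbb{K}=\mathbb{F}_2((T^{-1}))$; $\mathbb{P}=\{\sum_{i\ge1}\alpha_iT^{-i}\}\subset\mathbb{K}$ is the unit interval with Haar measure normalized to total mass $1$. $E(t)=(-1)^{\alpha_1}$, $\alpha_1$ the coefficient of $T^{-1}$ in $t$. Sums are over polynomials in $\mathbb{F}_2[T]$ (degree of $0$ is $-\infty$; $\deg U=0$ means $U=1$). For $t=\sum\alpha_iT^{-i}$, $D_{(1+m)\times k}(t)=(\alpha_{i+j-1})$ is the $(1+m)\times k$ persymmetric matrix; for $\eta=\sum\beta_iT^{-i}$, $D^{[1;1+m]\times k}(t,\eta)$ is the $(2+m)\times k$ matrix obtained by appending the row $(\beta_1,\dots,\beta_k)$ below $D_{(1+m)\times k}(t)$. $r$ is rank over $\mathbb{F}_2$.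 $\sigma_{i,i}^{[1;1+m]\times k}$ is the number of $(\alpha_1,\dots,\alpha_{k+m},\beta_1,\dots,\beta_k)\in\mathbb{F}_2^{2k+m}$ such that both $(\alpha_{i+j-1})_{(1+m)\times k}$ and this matrix with the row $(\beta_1,\dots,\beta_k)$ appended have rank $i$. *)

(* Defs.v *)
From HB Require Import structures.
From mathcomp Require Import all_boot all_order all_algebra.
From mathcomp Require Import all_classical all_reals all_analysis.

Set Implicit Arguments.
Unset Strict Implicit.
Unset Printing Implicit Defensive.

Import Order.TTheory GRing.Theory Num.Theory.
Import numFieldNormedType.Exports.

Local Open Scope classical_set_scope.
Local Open Scope ring_scope.

(* A function [c : int -> 'F_2] stands for the formal series
   \sum_n (c n) T^n; it is a Laurent series in T^-1 when only finitely many
   positive powers of T occur. *)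
Definition laurent_pred (c : int -> 'F_2) : bool :=
  `[< exists N : int, forall n : int, N < n -> c n = 0 >].

Fact laurent_zmod_closed : zmod_closed laurent_pred.
Proof.
split=> [|c d]; first by apply/asboolP; exists 0.
move=> /asboolP[N hN] /asboolP[M hM]; apply/asboolP; exists (Num.max N M) => n.
rewrite gt_max => /andP[Nn Mn].
have -> : (c - d) n = c n - d n by [].
by rewrite hN // hM // subr0.
Qed.
HB.instance Definition _ :=
  GRing.isZmodClosed.Build (int -> 'F_2) laurent_pred laurent_zmod_closed.

(* K = F_2((T^-1)) *)
Record laurent : Type :=
  Laurent { coefK :> int -> 'F_2; laurentP : laurent_pred coefK }.
HB.instance Definition _ := [isSub for coefK].
HB.instance Definition _ := [Choice of laurent by <:].
HB.instance Definition _ := [SubChoice_isSubZmodule of laurent by <:].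
HB.instance Definition _ := isPointed.Build laurent 0.

(* Cauchy product; the support of the summand is finite. *)
Definition conv (s t : int -> 'F_2) (n : int) : 'F_2 :=
  \sum_(i \in [set: int]) s i * t (n - i).

Fact conv_laurent (s t : laurent) : laurent_pred (conv s t).
Proof.
have /asboolP[N hN] := laurentP s; have /asboolP[M hM] := laurentP t.
apply/asboolP; exists (N + M) => n NMn; rewrite /conv fsbig1 // => i _.
have [/hN->|iN] := ltP N i; first by rewrite mul0r.
by rewrite hM ?mulr0 // ltrBrDl (le_lt_trans _ NMn) // lerD2r.
Qed.
Definition mulK (s t : laurent) : laurent := Laurent (conv_laurent s t).

Definition poly_coef (p : {poly 'F_2}) (n : int) : 'F_2 :=
  if n is Posz j then p`_j else 0.

Fact poly_laurent (p : {poly 'F_2}) : laurent_pred (poly_coef p).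
Proof.
apply/asboolP; exists (Posz (size p)) => -[j|j] //= pj.
by rewrite nth_default // ltnW.
Qed.
Definition polyK (p : {poly 'F_2}) : laurent := Laurent (poly_laurent p).

(* The T^-1-adic topology: the balls around [x] are the sets of series sharing
   with [x] all coefficients of T^n, n >= N. *)
Definition openK (A : set laurent) : Prop :=
  forall x, A x ->
    exists N : int, forall y : laurent, (forall n, N <= n -> y n = x n) -> A y.

Fact openKT : openK setT.
Proof. by move=> x _; exists 0. Qed.

Fact openKI (A B : set laurent) : openK A -> openK B -> openK (A `&` B).
Proof.
move=> oA oB x [/oA[N hN] /oB[M hM]]; exists (Num.min N M) => y hy.
by split; [apply: hN|apply: hM] => n h; apply: hy; rewrite ge_min h ?orbT.
Qed.

Fact openK_bigU (I : Type) (f : I -> set laurent) :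
  (forall i, openK (f i)) -> openK (\bigcup_i f i).
Proof.
by move=> of_ x [i _ /of_[N hN]]; exists N => y /hN; exists i.
Qed.
HB.instance Definition _ :=
  isOpenTopological.Build laurent openKT openKI openK_bigU.

Definition borelK := g_sigma_algebraType (@open laurent).

Definition unit_interval : set laurent :=
  [set t | forall n : int, 0 <= n -> t n = 0].

(* [mu] is the Haar measure of (K, +), normalized by mu P = 1. As P is a compact
   open subgroup, a translation invariant Borel measure with mu P = 1 is nonzero
   and finite on compact sets. *)
Definition is_haar (R : realType)
    (mu : {measure set borelK -> \bar R}) : Prop :=
  (forall (x : laurent) (A : set borelK), measurable A ->
     mu [set x + y | y in (A : set laurent)] = mu A) /\
  mu unit_interval = 1%E.

Definition E (R : realType) (t : laurent) : R := (-1) ^+ (t (-1)).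

Definition g (R : realType) (m k : nat) (t eta : laurent) : R :=
  \sum_(Y \in [set Y : {poly 'F_2} | (size Y <= k)%N])
    \sum_(Z \in [set Z : {poly 'F_2} | (size Z <= m.+1)%N])
      (E R (mulK (mulK t (polyK Y)) (polyK Z)) *
       \sum_(U \in [set U : {poly 'F_2} | size U = 1%N])
         E R (mulK (mulK eta (polyK Y)) (polyK U))).

(* [a n] is the entry written alpha_n, n >= 1; the row and column indices
   [i], [j] start from 0. *)
Definition persym (m k : nat) (a : nat -> 'F_2) : 'M['F_2]_(1 + m, k) :=
  \matrix_(i, j) a (i.+1 + j.+1 - 1)%N.

Definition persym1 (m k : nat) (a b : nat -> 'F_2) : 'M['F_2]_(1 + m + 1, k) :=
  col_mx (persym m k a) (\row_j b j.+1).

(* alpha_n: the coefficient of T^-n *)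
Definition digit (t : laurent) (n : nat) : 'F_2 := t (- n%:Z).

Definition D (m k : nat) (t : laurent) : 'M['F_2]_(1 + m, k) :=
  persym m k (digit t).

Definition D1 (m k : nat) (t eta : laurent) : 'M['F_2]_(1 + m + 1, k) :=
  persym1 m k (digit t) (digit eta).

(* sigma_{i,i}; alpha_n and beta_n are the entries of index n - 1 of the tuples
   [ab.1] and [ab.2]. *)
Definition sigma (m k i : nat) : nat :=
  #|[set ab : (k + m).-tuple 'F_2 * k.-tuple 'F_2 |
      (\rank (persym m k (fun n => ab.1`_n.-1)) == i) &&
      (\rank (persym1 m k (fun n => ab.1`_n.-1) (fun n => ab.2`_n.-1)) == i)]%SET|.

(* Main.v *)
Require Import Defs.
From HB Require Import structures.
From mathcomp Require Import all_boot all_order all_algebra.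
From mathcomp Require Import mxabelem.
From mathcomp Require Import all_classical all_reals all_analysis.
From mathcomp Require Import measurable_realfun ring.

Import Order.TTheory GRing.Theory Num.Theory.
Import numFieldNormedType.Exports.

Local Open Scope classical_set_scope.
Local Open Scope ring_scope.

(** Identify [Y], [Z] with vectors [y], [z] over F_2. Then [E (t Y Z)] is the sign
    of [z D(t) y] and [E (eta Y)] that of [b y], where [b] lists the digits of
    [eta]. Summing over [z] keeps only the [y] in the kernel of [D(t)], and the
    sum of the character [y |-> (-1)^(b y)] over this kernel vanishes unless [b]
    is orthogonal to it, i.e., unless [b] lies in the row space of [D(t)]. The
    moments follow since [g] depends only on finitely many digits, and by
    translation invariance each cylinder fixing [N] digits has measure
    [2^-N]. *)

(** * Character sums over F_2 *)

Lemma signr_F2D (R : pzRingType) (x y : 'F_2) :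
  (-1) ^+ (x + y)%R = (-1) ^+ x * (-1) ^+ y :> R.
Proof. by rewrite -exprD -[RHS]signr_odd -modn2. Qed.

Lemma signr_F2_neq0 (R : pzRingType) (x : 'F_2) :
  x != 0 -> (-1) ^+ x = -1 :> R.
Proof. by case: x => [[|[|]]] //= ? _; rewrite expr1. Qed.

(** If [A *m v] is nonzero, some row of [A] has sign -1 against [v]; translation by that row
    permutes the row space and negates every term, so the sum equals its own opposite. *)
Lemma sum_signr_rowspace (R : numDomainType) (p n : nat)
    (A : 'M['F_2]_(p, n)) (v : 'cV['F_2]_n) :
  \sum_(y : 'rV['F_2]_n | (y <= A)%MS) (-1) ^+ ((y *m v) 0 0) =
  (if A *m v == 0 then 2 ^+ \rank A else 0) :> R.
Proof.
case: eqP => [Av0|/eqP/matrix0Pn[i [j Avij]]].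
  rewrite (eq_bigr (fun=> 1)); last first.
    by move=> y /submxP[u ->]; rewrite -mulmxA Av0 mulmx0 mxE expr0.
  rewrite sumr_const -natrX; congr (_%:R).
  have := card_rowg A; rewrite card_Fp // => <-.
  by apply: eq_card => y; rewrite mem_rowg.
set S := LHS; suff SN : S = - S.
  have : S *+ 2 == 0 by rewrite mulr2n {1}SN addNr.
  by rewrite mulrn_eq0 => /eqP.
have y0A : (row i A <= A)%MS by exact: row_sub.
have y0v : (-1) ^+ ((row i A *m v) 0 0) = -1 :> R.
  by rewrite signr_F2_neq0 // -row_mul mxE -(ord1 j).
rewrite {1}/S (reindex_onto (+%R^~ (row i A)) (+%R^~ (- row i A))); last first.
  by move=> y _; rewrite addrNK.
rewrite /S -sumrN; apply: eq_big => [y|y _].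
  rewrite addrK eqxx andbT; apply/idP/idP => yA; last exact: addmx_sub.
  by rewrite -(addrK (row i A) y) addmx_sub // eqmx_opp.
by rewrite mulmxDl mxE signr_F2D y0v mulrN1.
Qed.

(** Duality: a row space is the annihilator of its kernel, and appending [b] preserves the rank
    exactly when [b] already lies in the row space. *)
Lemma rank_col_mx_eq (F : fieldType) (n k : nat)
    (M : 'M[F]_(n, k)) (b : 'rV[F]_k) :
  (\rank M == \rank (col_mx M b)) = (kermx M^T *m b^T == 0).
Proof.
have sM : (M <= col_mx M b)%MS by rewrite -addsmxE addsmxSl.
rewrite (mxrank_leqif_sup sM) -addsmxE addsmx_sub submx_refl /=.
apply/idP/eqP => [/submxP[u ->]|kb0].
  by rewrite trmx_mul mulmxA mulmx_ker mul0mx.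
(* Row space membership means [b *m cokermx M = 0], and the columns of [cokermx M] are kernel
   vectors of [M], to which [b] is orthogonal. *)
have cker : ((cokermx M)^T <= kermx M^T)%MS.
  by apply/sub_kermxP; rewrite -trmx_mul mulmx_coker trmx0.
rewrite submxE; have /submxP[u uE] := cker.
by rewrite -[b]trmxK -[cokermx M]trmxK uE -trmx_mul -mulmxA kb0 mulmx0 trmx0.
Qed.

Lemma sum_signr_bilinear (R : numFieldType) (n k : nat)
    (M : 'M['F_2]_(n, k)) (b : 'rV['F_2]_k) :
  \sum_(y : 'rV['F_2]_k) \sum_(z : 'rV['F_2]_n)
    (-1) ^+ ((z *m (M *m y^T)) 0 0) * (-1) ^+ ((y *m b^T) 0 0) =
  (if \rank M == \rank (col_mx M b) then 2 ^ ((k + n)%N%:Z - (\rank M)%:Z)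
   else 0) :> R.
Proof.
under eq_bigr => y _.
  (* The sum over [z] runs over the row space of the identity: it is 2^n if [M *m y^T = 0] and 0
     otherwise. *)
  rewrite -big_distrl /=.
  under eq_bigl => z do rewrite -(submx1 z).
  rewrite sum_signr_rowspace mul1mx mxrank1 (fun_if (fun x => x * _)) mul0r.
  over.
rewrite -big_mkcond /= -big_distrr /=.
have kerE (y : 'rV['F_2]_k) : (M *m y^T == 0) = (y <= kermx M^T)%MS.
  rewrite -(inj_eq (@trmx_inj _ _ _)) trmx0 trmx_mul trmxK.
  by apply/eqP/sub_kermxP.
under eq_bigl => y do rewrite kerE.
rewrite sum_signr_rowspace -rank_col_mx_eq mxrank_ker mxrank_tr.
case: ifP => _; rewrite ?mulr0 // -exprD.
have rk : (\rank M <= k)%N by exact: rank_leq_col.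
rewrite addnBA // subzn ?(leq_trans rk) ?leq_addr //.
by rewrite -exprnP addnC.
Qed.

(** * From polynomials and series to vectors and matrices *)

Lemma mulK_polyK (s : laurent) (p : {poly 'F_2}) (d : nat) (n : int) :
  (size p <= d)%N -> mulK s (polyK p) n = \sum_(j < d) s (n - j%:Z) * p`_j.
Proof.
(* The factor from [p] vanishes at [n - i] outside [0, d), so the listed indices cover the
   support. *)
move=> pd; rewrite /= /Defs.conv (fsbigE [seq n - j%:Z | j <- iota 0 d]) //.
- under eq_bigl do rewrite in_setT.
  rewrite -(big_mkord xpredT (fun j : nat => s (n - j%:Z) * p`_j)).
  rewrite big_map /index_iota subn0.
  by apply: eq_bigr => j _; rewrite subKr.
- by rewrite map_inj_uniq ?iota_uniq // => i j /addrI/oppr_inj[].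
- move=> i _ /mapP ni; case E : (n - i) => [j|j] /=; rewrite ?mulr0 //.
  rewrite nth_default ?mulr0 // (leq_trans pd) // leqNgt; apply/negP => jd.
  by apply: ni; exists j; rewrite ?mem_iota // -E subKr.
Qed.

Lemma fsbig_size_le (R : nmodType) (d : nat) (F : {poly 'F_2} -> R) :
  \sum_(Y \in [set Y : {poly 'F_2} | (size Y <= d)%N]) F Y =
  \sum_(y : 'rV['F_2]_d) F (rVpoly y).
Proof.
rewrite -(big_map rVpoly xpredT F); apply: fsbig_fwiden.
- move=> Y /= Yd; apply/mapP; exists (poly_rV Y); first exact: mem_index_enum.
  by rewrite poly_rV_K.
- by rewrite map_inj_uniq ?index_enum_uniq //; exact: can_inj rVpolyK.
- by move=> Y [/= /mapP[y _ ->]] []; exact: size_poly.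
Qed.

Lemma gE (R : realType) (m k : nat) (t eta : laurent) :
  g R m k t eta =
  if \rank (D m k t) == \rank (D1 m k t eta)
  then 2 ^ ((k + m + 1)%N%:Z - (\rank (D m k t))%:Z)
  else 0.
Proof.
have -> : (k + m + 1 = k + (1 + m))%N by rewrite -addnA (addnC m).
rewrite /D1 /persym1 -sum_signr_bilinear /g fsbig_size_le.
apply: eq_bigr => y _; rewrite fsbig_size_le; apply: eq_bigr => z _.
have size_rV d (x : 'rV['F_2]_d) : (size (rVpoly x) <= d)%N by exact: size_poly.
(* The only nonzero constant over F_2 is 1. *)
have -> : [set U : {poly 'F_2} | size U = 1%N] = [set 1].
  apply/seteqP; split => U /=; last by move->; rewrite size_poly1.
  move=> U1; have /size_poly1P[c c0 ->] : size U == 1%N by rewrite U1.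
  by rewrite -polyC1; congr (_%:P); case: c c0 => [[|[|]]] // ? _; exact: val_inj.
rewrite fsbig_set1 /E (mulK_polyK _ 1 1) ?size_poly1 // big_ord1.
rewrite coef1 mulr1 subr0 !(mulK_polyK _ _ _ _ (size_rV _ _)).
congr (_ * _); congr (_ ^+ _); congr (nat_of_ord _); rewrite !mxE.
- apply: eq_bigr => i _; rewrite coef_rVpoly_ord mulrC mxE; congr (_ * _).
  rewrite (mulK_polyK _ _ _ _ (size_rV _ _)).
  apply: eq_bigr => j _; rewrite coef_rVpoly_ord !mxE /digit; congr (t _ * _).
  by rewrite !addSn addnS subn1 /= -!opprD -!PoszD.
- apply: eq_bigr => j _; rewrite coef_rVpoly_ord !mxE /digit mulrC.
  by congr (_ * eta _); rewrite -opprD.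
Qed.

(** * Cylinders and their Haar measure *)

Definition digits (N : nat) (t : laurent) : N.-tuple 'F_2 :=
  [tuple digit t i.+1 | i < N].

Definition cylinder (N : nat) (a : N.-tuple 'F_2) : set borelK :=
  [set t : laurent | unit_interval t /\ digits N t = a].

Lemma nth_digits (N : nat) (t : laurent) (i : nat) :
  (i < N)%N -> (digits N t)`_i = digit t i.+1.
Proof.
move=> iN; rewrite -[i]/(nat_of_ord (Ordinal iN)) -tnth_nth.
by rewrite tnth_mktuple.
Qed.

Lemma measurable_openK (A : set laurent) :
  openK A -> measurable (A : set borelK).
Proof. by move=> oA; apply: sub_sigma_algebra. Qed.

Lemma measurable_unit_interval : measurable (unit_interval : set borelK).
Proof.
by apply: measurable_openK => x Px; exists 0 => y yx n n0; rewrite yx // Px.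
Qed.

Lemma measurable_cylinder (N : nat) (a : N.-tuple 'F_2) :
  measurable (cylinder N a).
Proof.
apply: measurable_openK => x [Px <-]; exists (- N%:Z) => y yx; split.
  by move=> n n0; rewrite yx ?Px // (le_trans _ n0) // oppr_le0.
apply: eq_from_tnth => i; rewrite !tnth_mktuple /digit yx //.
by rewrite lerN2 lez_nat.
Qed.

(** [Negz j] is -(j+1), so entry [j] of [s] becomes the coefficient of T^-(j+1); entries past the
    end of [s] default to 0. *)
Fact series_of_digits_laurent (s : seq 'F_2) :
  laurent_pred (fun n : int => if n is Negz j then s`_j else 0).
Proof. by apply/asboolP; exists 0 => -[]. Qed.

Definition series_of_digits (s : seq 'F_2) : laurent :=
  Laurent (series_of_digits_laurent s).

(** This lets translation invariance give all cylinders of length [N] the same measure. *)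
Lemma cylinder_translate (N : nat) (a : N.-tuple 'F_2) :
  cylinder N a =
  [set series_of_digits a + y | y in (cylinder N [tuple 0 | i < N] : set laurent)].
Proof.
have digit_series i : digit (series_of_digits a) i.+1 = a`_i by [].
apply/seteqP; split => [t [Pt ta]|_ [y [Py y0] <-]].
  exists (t - series_of_digits a); last by rewrite addrC subrK.
  split=> [n n0|].
    have -> : (t - series_of_digits a) n = t n - series_of_digits a n by [].
    by rewrite Pt // sub0r; case: n n0 => //= n _; rewrite oppr0.
  apply: eq_from_tnth => i; rewrite !tnth_mktuple.
  have -> : digit (t - series_of_digits a) i.+1 =
    digit t i.+1 - digit (series_of_digits a) i.+1 by [].
  by rewrite digit_series -ta nth_digits // subrr.
split=> [n n0|].
  have -> : (series_of_digits a + y) n = series_of_digits a n + y n by [].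
  by rewrite Py // addr0; case: n n0.
apply: eq_from_tnth => i; rewrite tnth_mktuple.
have -> : digit (series_of_digits a + y) i.+1 =
  digit (series_of_digits a) i.+1 + digit y i.+1 by [].
rewrite digit_series -(nth_digits N) // y0 -tnth_nth -tnth_nth.
by rewrite tnth_mktuple addr0.
Qed.

(** On the unit interval the integrand is a finite nonnegative combination of indicators of
    cylinders. The measure is arbitrary here, so that [F = 1] can serve to compute the Haar measure
    of a cylinder. *)
Lemma integral_digits_cylinder (R : realType)
    (mu : {measure set borelK -> \bar R}) (N : nat) (F : N.-tuple 'F_2 -> R) :
  (forall a, 0 <= F a) ->
  (\int[mu]_(t in unit_interval) (F (digits N t))%:E =
   \sum_(a : N.-tuple 'F_2) (F a)%:E * mu (cylinder N a))%E.
Proof.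
move=> F0; have mP := measurable_unit_interval.
have mc := measurable_cylinder N.
have m1 a : measurable_fun (unit_interval : set borelK)
    (EFin \o (\1_(cylinder N a) : borelK -> R)).
  by apply/measurable_EFinP; exact: measurable_indic.
transitivity (\int[mu]_(t in unit_interval)
    \sum_(a : N.-tuple 'F_2) (F a)%:E * (\1_(cylinder N a) t)%:E)%E.
  apply: eq_integral => t /set_mem Pt.
  rewrite (bigD1 (digits N t)) //= big1 ?adde0; last first.
    move=> a /eqP at_; rewrite indicE memNset ?mule0 // => -[_ ta].
    by apply: at_.
  by rewrite indicE mem_set ?mule1 //; split.
rewrite ge0_integral_sum //; last 2 first.
- by move=> a; apply: measurable_funeM; exact: m1.
- by move=> a t _; rewrite mule_ge0 // lee_fin ?F0.
apply: eq_bigr => a _; rewrite ge0_integralZl_EFin //; last exact: m1.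
rewrite integral_indic //; congr (_ * mu _)%E.
by apply/setIidl => t [].
Qed.

Lemma haar_cylinder (R : realType) (mu : {measure set borelK -> \bar R})
    (N : nat) (a : N.-tuple 'F_2) :
  is_haar mu -> mu (cylinder N a) = ((2 ^+ N)^-1)%:E.
Proof.
move=> [muT muP].
have muE b : mu (cylinder N b) = mu (cylinder N [tuple 0 | i < N]).
  by rewrite [in LHS]cylinder_translate muT //; exact: measurable_cylinder.
rewrite muE; set c := mu _ in muE *.
(* The 2^N cylinders partition the unit interval, which has mass 1. *)
have sumc : (\sum_(b : N.-tuple 'F_2) c = 1)%E.
  rewrite -muP -[RHS]mul1e -(integral_cst mu measurable_unit_interval 1%E).
  rewrite (integral_digits_cylinder R mu N (fun=> 1)) //.
  by apply: eq_bigr => b _; rewrite muE mul1e.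
(* Finiteness of [c] moves the equation 2^N c = 1 from the extended reals to [R]. *)
have c0 : (0 <= c)%E by exact: measure_ge0.
have c1 : (c <= 1)%E.
  by rewrite -sumc (bigD1 a) //= leeDl // sume_ge0.
have cfin : c \is a fin_num.
  by rewrite ge0_fin_numE // (le_lt_trans c1) // ltry.
move: sumc; rewrite -(fineK cfin) sumEFin => -[].
rewrite sumr_const card_tuple card_Fp // => fc.
have -> : fine c = (2 ^+ N)^-1; last by [].
apply: (mulIf (_ : 2 ^+ N != 0 :> R)); first by rewrite expf_neq0 // pnatr_eq0.
by rewrite mulVf ?expf_neq0 ?pnatr_eq0 // -natrX mulr_natr.
Qed.

Lemma integral_digits (R : realType) (mu : {measure set borelK -> \bar R})
    (N : nat) (F : N.-tuple 'F_2 -> R) :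
  is_haar mu -> (forall a, 0 <= F a) ->
  (\int[mu]_(t in unit_interval) (F (digits N t))%:E)%E =
  ((2 ^+ N)^-1 * \sum_(a : N.-tuple 'F_2) F a)%:E.
Proof.
move=> hmu F0; rewrite integral_digits_cylinder // mulr_sumr -sumEFin.
by apply: eq_bigr => a _; rewrite haar_cylinder // -EFinM mulrC.
Qed.

(** * Moments of [g] *)

Lemma persym_digits (m k : nat) (t : laurent) :
  D m k t = persym m k (fun n => (digits (k + m) t)`_n.-1).
Proof.
apply/matrixP => i j; rewrite !mxE !addSn addnS subn1 /= nth_digits //.
(* With [i <= m] and [j < k], the position [i + j] stays below [k + m]. *)
by rewrite -addnS (addnC k) leq_add // -ltnS.
Qed.

Lemma persym1_digits (m k : nat) (t eta : laurent) :
  D1 m k t eta = persym1 m k (fun n => (digits (k + m) t)`_n.-1)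
                             (fun n => (digits k eta)`_n.-1).
Proof.
rewrite /D1 /persym1; congr col_mx; first exact: persym_digits.
by apply/rowP => j; rewrite !mxE /= nth_digits.
Qed.

(** Double counting: a pair with equal ranks is counted by [sigma] only at [i] equal to that common
    rank, which is at most [minn k (1 + m)]; any other pair is never counted. *)
Lemma sum_sigma (R : pzRingType) (m k : nat) (X : nat -> R) :
  \sum_(0 <= i < (minn k (1 + m)).+1) (sigma m k i)%:R * X i =
  \sum_(ab : (k + m).-tuple 'F_2 * k.-tuple 'F_2)
    let r := \rank (persym m k (fun n => ab.1`_n.-1)) in
    if r == \rank (persym1 m k (fun n => ab.1`_n.-1) (fun n => ab.2`_n.-1))
    then X r else 0.
Proof.
rewrite big_mkord.
under eq_bigr => i _.
  rewrite /sigma mulr_natl -sumr_const big_mkcond /=.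
  over.
rewrite exchange_big; apply: eq_bigr => -[a b] _ /=.
have rmin : (\rank (persym m k (fun n => a`_n.-1)%R) < (minn k (1 + m)).+1)%N.
  by rewrite ltnS leq_min rank_leq_col rank_leq_row.
rewrite (bigD1 (Ordinal rmin)) //= big1 ?addr0 => [|i /eqP ir].
  by rewrite inE /= eqxx /= eq_sym.
rewrite inE /=; case: eqP => //= ri; case: ir; exact: val_inj.
Qed.

Theorem theorem1p6 (R : realType) (k m q : nat)
    (hk : (1 <= k)%N) (hq : (1 <= q)%N) :
  (forall t eta : laurent, unit_interval t -> unit_interval eta ->
     g R m k t eta =
       if \rank (D m k t) == \rank (D1 m k t eta)
       then 2 ^ ((k + m + 1)%N%:Z - (\rank (D m k t))%:Z)
       else 0) /\
  (forall mu : {measure set borelK -> \bar R}, is_haar mu ->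
     (\int[mu]_(eta in unit_interval)
        \int[mu]_(t in unit_interval) ((g R m k t eta) ^+ q)%:E)%E =
     (2 ^ ((q * (k + m + 1))%N%:Z - (2 * k + m)%N%:Z) *
       \sum_(0 <= i < (minn k (1 + m)).+1)
         (sigma m k i)%:R * 2 ^ (- (i * q)%N%:Z))%:E).
Proof.
split=> [t eta _ _|mu hmu]; first exact: gE.
pose r (a : (k + m).-tuple 'F_2) := \rank (persym m k (fun n => a`_n.-1)).
pose r1 (a : (k + m).-tuple 'F_2) (b : k.-tuple 'F_2) :=
  \rank (persym1 m k (fun n => a`_n.-1) (fun n => b`_n.-1)).
pose G a b : R :=
  (if r a == r1 a b then 2 ^ ((k + m + 1)%N%:Z - (r a)%:Z) else 0) ^+ q.
have G0 a b : 0 <= G a b.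
  by rewrite exprn_ge0 //; case: ifP => // _; rewrite exprz_ge0.
have gG t eta : g R m k t eta ^+ q = G (digits (k + m) t) (digits k eta).
  by rewrite gE persym_digits persym1_digits.
under eq_integral => eta _.
  under eq_integral => t _ do rewrite gG.
  rewrite (integral_digits R mu (k + m) (G^~ (digits k eta))) //.
  over.
rewrite (integral_digits R mu k
  (fun b => (2 ^+ (k + m))^-1 * \sum_a G a b)) //; last first.
  by move=> b; rewrite mulr_ge0 ?sumr_ge0 // invr_ge0 exprn_ge0.
(* The cylinder measures 2^-k and 2^-(k+m) combine into the factor 2^-(2k+m). *)
congr (_%:E); rewrite -big_distrr /= mulrA exchange_big pair_big /=.
rewrite (sum_sigma R m k (fun i => 2 ^ (- (i * q)%N%:Z))) !mulr_sumr.
have n20 : 2 != 0 :> R by rewrite pnatr_eq0.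
apply: eq_bigr => -[a b] _; rewrite /= /G -/(r a) -/(r1 a b).
(* Where [g] vanishes, its power is 0 because [q] is positive. *)
case: ifP => _; last by rewrite expr0n eqn0Ngt hq !mulr0.
rewrite -invfM -exprD !exprnP invr_expz exprz_exp -!expfzDr //.
by congr (_ ^ _); rewrite !PoszD !PoszM; ring.
Qed.
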